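(* Let $X$ be a compact metric space and $f\colon X\to X$ a continuous map with the shadowing property. If $\dim X=0$ and $h_{top}(f)>0$, then there exist a Mycielski subset $S$ of $X$ and numbers $\delta_n>0$ ($n\ge2$) such that $S$ is distributionally $n$-$\delta_n$-scrambled for all $n\ge2$.
   Context: $(X,d)$ is a compact metric space, $h_{top}$ denotes topological entropy. For $\delta>0$, a sequence $(x_i)_{i\ge0}$ in $X$ is a $\delta$-pseudo orbit of $f$ if $d(f(x_i),x_{i+1})\le\delta$ for all $i\ge0$; it is $\epsilon$-shadowed by $x\in X$ if $d(f^i(x),x_i)\le\epsilon$ for all $i\ge0$. $f$ has the shadowing property if for every $\epsilon>0$ there is $\delta>0$ such that every $\delta$-pseudo orbit of $f$ is $\epsilon$-shadowed by some point of $X$. A Mycielski set is a countable union of Cantor sets. For $n\ge2$ and $\delta>0$, an $n$-tuple $(x_1,\dots,x_n)\in X^n$ is distributionally $n$-$\delta$-scrambled if for every $\epsilon>0$, $\limsup_{m\to\infty}\frac1m|\{0\le k\le m-1:\max_{1\le i<j\le n}d(f^k(x_i),f^k(x_j))<\epsilon\}|=1$, and $\limsup_{m\to\infty}\frac1m|\{0\le k\le m-1:\min_{1\le i<j\le n}d(f^k(x_i),f^k(x_j))>\delta\}|=1$. A set $S\subset X$ is distributionally $n$-$\delta$-scrambled if every $n$-tuple of distinct points of $S$ is distributionally $n$-$\delta$-scrambled. *)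

(* Defs.v *)
From HB Require Import structures.
From mathcomp Require Import all_boot all_order all_algebra.
From mathcomp Require Import all_classical all_reals all_analysis.
From Stdlib Require List.
Set Implicit Arguments. Unset Strict Implicit. Unset Printing Implicit Defensive.
Import Order.TTheory GRing.Theory Num.Theory.
Local Open Scope classical_set_scope.
Local Open Scope ring_scope.

Section Defs.
Variables (R : realType) (X : Type) (d : X -> X -> R).

Definition is_metric : Prop :=
  (forall x y, 0 <= d x y) /\ (forall x y, d x y = 0 <-> x = y) /\
  (forall x y, d x y = d y x) /\ (forall x y z, d x z <= d x y + d y z).

Definition mopen (U : set X) : Prop :=
  forall x, U x -> exists2 r : R, 0 < r & forall y, d x y < r -> U y.

Definition mclosed (F : set X) : Prop := mopen (~` F).

Definition mcompact : Prop :=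
  forall (I : Type) (U : I -> set X), (forall i, mopen (U i)) ->
    (forall x, exists i, U i x) ->
    exists s : seq I, forall x, exists i, Stdlib.Lists.List.In i s /\ U i x.

Definition mcontinuous (f : X -> X) : Prop :=
  forall x (eps : R), 0 < eps -> exists2 delta : R, 0 < delta &
    forall y, d x y < delta -> d (f x) (f y) < eps.

Definition pseudo_orbit (f : X -> X) (delta : R) (xs : nat -> X) : Prop :=
  forall i, d (f (xs i)) (xs i.+1) <= delta.
Definition shadowed (f : X -> X) (eps : R) (xs : nat -> X) (x : X) : Prop :=
  forall i, d (iter i f x) (xs i) <= eps.
Definition shadowing (f : X -> X) : Prop :=
  forall eps : R, 0 < eps -> exists2 delta : R, 0 < delta &
    forall xs, pseudo_orbit f delta xs -> exists x, shadowed f eps xs x.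

(* dim X = 0 (small inductive dimension 0): X is nonempty and has a base
   of clopen sets. *)
Definition dim_zero : Prop :=
  (exists x : X, True) /\
  forall x U, mopen U -> U x ->
    exists V, [/\ mopen V, mclosed V, V x & V `<=` U].

Definition separated (f : X -> X) (n : nat) (eps : R) (m : nat)
    (e : 'I_m -> X) : Prop :=
  injective e /\ forall i j, i != j ->
    exists2 k, (k < n)%N & eps < d (iter k f (e i)) (iter k f (e j)).

(* (1/n) log s(n,eps), s(n,eps) = maximal cardinality of an
   (n,eps)-separated set *)
Definition sep_rate (f : X -> X) (eps : R) (n : nat) : \bar R :=
  ereal_sup [set r | exists m (e : 'I_m -> X),
     [/\ (0 < m)%N, separated f n eps e & r = (ln m%:R / n%:R)%:E]].

(* h_top(f) = lim_{eps -> 0} limsup_n (1/n) log s(n,eps)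
            = sup_{eps > 0} limsup_n (1/n) log s(n,eps) *)
Definition htop (f : X -> X) : \bar R :=
  ereal_sup [set limn_esup (sep_rate f eps) | eps in [set e : R | 0 < e]].

Definition cantor_subset (C : set X) : Prop :=
  exists g : (nat -> bool) -> X,
    [/\ C = range g, injective g,
        (* g continuous (product topology on {0,1}^N) *)
        (forall a (eps : R), 0 < eps -> exists N, forall b,
           (forall i, (i < N)%N -> a i = b i) -> d (g a) (g b) < eps) &
        (* g^-1 continuous on C *)
        (forall a N, exists2 delta : R, 0 < delta & forall b,
           d (g a) (g b) < delta -> forall i, (i < N)%N -> a i = b i)].

Definition mycielski (S : set X) : Prop :=
  exists Cs : nat -> set X, (forall k, cantor_subset (Cs k)) /\
    S = \bigcup_k Cs k.

Definition upper_density_one (P : nat -> Prop) : Prop :=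
  limn_esup (fun m : nat =>
    ((#|[set k : 'I_m | `[< P (nat_of_ord k) >]]|)%:R / m%:R : R)%:E)
  = 1%:E.

Definition dist_scrambled_tuple (f : X -> X) (n : nat) (delta : R)
    (x : 'I_n -> X) : Prop :=
  (forall eps : R, 0 < eps -> upper_density_one (fun k =>
     forall i j : 'I_n, (i < j)%N -> d (iter k f (x i)) (iter k f (x j)) < eps))
  /\ upper_density_one (fun k =>
     forall i j : 'I_n, (i < j)%N -> delta < d (iter k f (x i)) (iter k f (x j))).

Definition dist_scrambled_set (f : X -> X) (n : nat) (delta : R)
    (S : set X) : Prop :=
  forall x : 'I_n -> X, injective x -> (forall i, S (x i)) ->
    dist_scrambled_tuple f delta x.

End Defs.

(* Main.v *)
(* At scale delta, read orbits through a finite net as paths of a finite graph.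
   Positive entropy yields, at one vertex of this graph, two loops of equal length
   separated by a constant that does not depend on delta: the itineraries would
   otherwise be determined by the first and last visit times to each vertex, of
   which there are only polynomially many.  At each level we keep a set of vertices
   any two of which are joined by a path of one common length.  A real orbit
   shadowing a path that contains all words of a level infinitely often, read
   through a finer net, gives a next level to which every word of the previous
   level lifts up to a small error.
   A point of the scrambled set is the limit of words, one per level: each is a
   lift of the previous one followed by a phase much longer than all the past.  In
   a phase finitely many symbols are assigned to the points; points with the same
   symbol follow the same path of the current level, points with different symbols
   follow lifts of sequences of the two initial loops which differ with bounded
   gaps, with a bound depending only on the number of symbols.  Every assignment of
   symbols to prefixes occurs infinitely often.  A single Cantor set suffices. *)
Require Import Defs.
From mathcomp Require Import all_boot all_order all_algebra.
From mathcomp Require Import all_classical all_reals all_analysis.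
From mathcomp Require Import lra zify.
Set Implicit Arguments. Unset Strict Implicit. Unset Printing Implicit Defensive.
Import Order.TTheory GRing.Theory Num.Theory.
Local Open Scope classical_set_scope.
Local Open Scope ring_scope.

(** * Walks in finite graphs *)

Section Combinatorics.
Local Open Scope nat_scope.

Section Walks.
Variable (V : Type) (e : V -> V -> Prop).

Definition walk (p : nat -> V) (n : nat) : Prop :=
  forall i, i < n -> e (p i) (p i.+1).

Definition join (n : nat) (p q : nat -> V) : nat -> V :=
  fun i => if i < n then p i else q (i - n).

Lemma join_le n p q i : p n = q 0 -> i <= n -> join n p q i = p i.
Proof.
rewrite /join leq_eqVlt => pq /orP[/eqP->|->//].
by rewrite ltnn subnn.
Qed.

Lemma join_add n p q i : join n p q (n + i) = q i.
Proof. by rewrite /join ltnNge leq_addr /= addKn. Qed.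

Lemma walk_join n m p q : p n = q 0 -> walk p n -> walk q m ->
  walk (join n p q) (n + m).
Proof.
move=> pq wp wq i im; case: (ltnP i n) => [ltin|lein].
  by rewrite !(join_le pq) //; [exact: wp | exact: ltnW].
rewrite -(subnKC lein) -addnS !join_add; apply: wq.
by rewrite ltn_subLR.
Qed.

Lemma walk_shift n m p : walk p (n + m) -> walk (fun i => p (n + i)) m.
Proof. by move=> wp i im; rewrite addnS; apply: wp; rewrite ltn_add2l. Qed.

Definition reach (n : nat) (a b : V) : Prop :=
  exists p, [/\ p 0 = a, p n = b & walk p n].

Lemma reach_add n m a b c : reach n a b -> reach m b c -> reach (n + m) a c.
Proof.
move=> [p [p0 pn wp]] [q [q0 qm wq]]; have pq : p n = q 0 by rewrite pn q0.
exists (join n p q); split; last exact: walk_join.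
  by rewrite (join_le pq).
by rewrite join_add.
Qed.

(** One length [K] serves all ordered pairs, also [a = b], so words can be chained with gaps of
    known length. *)
Definition linked (E : V -> Prop) (K : nat) : Prop :=
  [/\ 0 < K, exists v, E v & forall a b, E a -> E b -> reach K a b].

Lemma linked_reach E K k a b : linked E K -> E a -> E b -> 0 < k ->
  reach (k * K) a b.
Proof.
move=> [_ _ lk] Ea Eb; elim: k => // -[_ _|k IH _]; first by rewrite mul1n; apply: lk.
rewrite mulSnr; apply: (reach_add (b := b)); first exact: IH.
exact: lk.
Qed.

(** Only the endpoints must lie in [E]. A length divisible by [K] lets [linked_reach] fill the gap
    up to any later multiple of [K]. *)
Definition word (E : V -> Prop) (K : nat) (n : nat) (p : nat -> V) : Prop :=
  [/\ E (p 0), E (p n), walk p n & K %| n].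

Lemma word_link E K n m p q : linked E K -> word E K n p -> word E K m q ->
  exists r, [/\ word E K (n + K + m) r, forall i, i <= n -> r i = p i &
    forall i, r (n + K + i) = q i].
Proof.
move=> lk [p0 pn wp dn] [q0 qm wq dm]; have [_ _ lk1] := lk.
have [l [l0 lK wl]] := lk1 _ _ pn q0.
have pl : p n = l 0 by [].
have plq : join n p l (n + K) = q 0 by rewrite join_add.
exists (join (n + K) (join n p l) q); split.
- split.
  + by rewrite (join_le plq) // (join_le pl).
  + by rewrite join_add.
  + by apply: walk_join => //; apply: walk_join.
  + by rewrite !dvdn_add.
- move=> i le_in; rewrite (join_le plq) ?(join_le pl) //.
  by rewrite (leq_trans le_in) ?leq_addr.
- by move=> i; rewrite join_add.
Qed.

Lemma word_ext E K n p q : (forall i, i <= n -> q i = p i) ->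
  word E K n p -> word E K n q.
Proof.
move=> pq [p0 pn wp dn]; split => //; rewrite ?pq //.
by move=> i ltin; rewrite (pq _ ltin) (pq _ (ltnW ltin)); apply: wp.
Qed.

End Walks.

Lemma injective_unbounded (g : nat -> nat) (R : nat) : injective g ->
  exists k, R <= g k.
Proof.
move=> injg; have [//|H] := pselect (exists k, R <= g k).
have ltg k : g k < R by rewrite ltnNge; apply/negP => le; apply: H; exists k.
have /leq_card : injective (fun k : 'I_R.+1 => Ordinal (ltg k)).
  by move=> i j [/injg/val_inj].
by rewrite !card_ord ltnn.
Qed.

Lemma fact_mul_ge r K T : 0 < K -> T < r`! * K * T.+1.
Proof. by move=> K0; rewrite leq_pmull // muln_gt0 fact_gt0. Qed.

(* Listing every word infinitely often, and waiting before the r-th one until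
   a time divisible by r!, makes occurrence times eventually congruent modulo
   any given period. *)
Lemma universal_walk (V : countType) (e : V -> V -> Prop) (E : V -> Prop) (K : nat) :
  linked e E K ->
  exists (p : nat -> V) (t : nat -> nat),
    [/\ forall n, walk e p n, forall r, t r < t r.+1, forall r, r`! %| t r &
      forall n w, word e E K n w -> forall R, exists r,
        [/\ R <= r, forall i, i <= n -> p (t r + i) = w i & t r + n <= t r.+1]].
Proof.
move=> lk; have [K0 [v0 Ev0] _] := lk.
pose good (x : nat * (nat -> V)) := word e E K x.1 x.2.
(* The factor [y.1.+1] puts [w] beyond the end of [y], at a time divisible by [K] and by the
   factorial of [r]. *)
pose nxt r (w y : nat * (nat -> V)) (z : nat * (nat -> V)) :=
  [/\ good z, forall i, i <= y.1 -> z.2 i = y.2 i,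
      forall i, i <= w.1 -> z.2 (r`! * K * y.1.+1 + i) = w.2 i &
      z.1 = r`! * K * y.1.+1 + w.1].
have step r w y : good w -> good y -> exists z, nxt r w y z.
  move=> [w0 wn ww dw] [y0 yn wy dy]; set T := r`! * K * y.1.+1.
  have ltT : y.1 < T := fact_mul_ge _ _ K0.
  have dT : K %| T - y.1 by rewrite dvdn_sub // /T -mulnA dvdn_mull // dvdn_mulr.
  have [l [l0 lT wl]] : reach e (T - y.1) (y.2 y.1) (w.2 0).
    rewrite -(divnK dT); apply: (linked_reach lk) => //.
    by rewrite divn_gt0 // dvdn_leq // subn_gt0.
  have TE : T = y.1 + (T - y.1) by rewrite subnKC // ltnW.
  have yl : y.2 y.1 = l 0 by [].
  have ylw : join y.1 y.2 l T = w.2 0 by rewrite TE join_add.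
  exists (T + w.1, join T (join y.1 y.2 l) w.2); split=> //=.
  - split => /=.
    + by rewrite (join_le ylw) // (join_le yl).
    + by rewrite join_add.
    + by apply: walk_join => //; rewrite TE; apply: walk_join.
    + by rewrite dvdn_add // /T -mulnA dvdn_mull // dvdn_mulr.
  - move=> i iy; rewrite (join_le ylw) ?(join_le yl) //.
    by rewrite (leq_trans iy) // ltnW.
  - by move=> i iw; rewrite join_add.
have g0 : good (0, fun=> v0) by split.
(* The second coordinate gives every list infinitely many codes; an index that encodes no word gets
   the word of length 0 at [v0]. *)
pose dec (r : nat) : nat * (nat -> V) :=
  if (unpickle r : option (seq V * nat)) is Some (s, _)
  then ((size s).-1, nth v0 s) else (0, fun=> v0).
pose wd r := if `[< good (dec r) >] then dec r else (0, fun=> v0).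
have gwd r : good (wd r) by rewrite /wd; case: ifPn => // /asboolP.
have /choice[F HF] : forall ry : nat * (nat * (nat -> V)), exists z,
    good ry.2 -> nxt ry.1 (wd ry.1) ry.2 z.
  move=> [r y]; have [gy|ngy] := pselect (good y); last by exists y.
  by have [z] := step r _ _ (gwd r) gy; exists z.
pose S := fix S r := if r is r'.+1 then F (r', S r') else (0, fun=> v0).
have gS r : good (S r).
  by elim: r => [|r IH] //=; have [] := HF (r, S r) IH.
have HS r : nxt r (wd r) (S r) (S r.+1) := HF (r, S r) (gS r).
pose t r := r`! * K * (S r).1.+1.
have tS r : t r + (wd r).1 = (S r.+1).1 by have [_ _ _ ->] := HS r.
have St r : (S r).1 < t r by apply: fact_mul_ge.
have ltS r : (S r).1 < (S r.+1).1.
  by rewrite -tS (leq_trans (St r)) ?leq_addr.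
have leS r k : (S r).1 <= (S (r + k)).1.
  by elim: k => [|k IH]; rewrite ?addn0 // addnS (leq_trans IH) // ltnW.
have geS r : r <= (S r).1 by elim: r => // r IH; exact: leq_ltn_trans (ltS r).
have agree r k i : i <= (S r).1 -> (S (r + k)).2 i = (S r).2 i.
  move=> ir; elim: k => [|k IH]; first by rewrite addn0.
  rewrite addnS; have [_ H _ _] := HS (r + k); rewrite H ?IH //.
  exact: leq_trans ir (leS r k).
(* The diagonal is consistent: stage [i] has length at least [i], and later stages extend it. *)
pose p i := (S i).2 i.
have pE r i : i <= (S r).1 -> p i = (S r).2 i.
  move=> ir; rewrite /p; have [le|/ltnW le] := leqP r i.
    by have := agree r (i - r) i ir; rewrite subnKC.
  by have := agree i (r - i) i (geS i); rewrite subnKC.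
exists p, t; split.
- move=> n i _; rewrite (pE i.+1) ?(pE i.+1 i.+1) //; last first.
    by rewrite (leq_trans (leqnSn i)).
  have [_ _ wS _] := gS i.+1.
  by apply: wS.
- move=> r; apply: leq_ltn_trans (St r.+1).
  by rewrite -tS leq_addr.
- by move=> r; rewrite /t -mulnA dvdn_mulr.
- move=> n w gw R.
  pose s := mkseq w n.+1.
  have sE i : i <= n -> nth v0 s i = w i by move=> le; rewrite nth_mkseq.
  have gs : good (n, nth v0 s).
    case: gw => w0 wn ww dn; split => //=; rewrite ?sE //.
    by move=> i ltin; rewrite (sE _ ltin) (sE _ (ltnW ltin)); apply: ww.
  have [k Rk] : exists k : nat, R <= pickle (s, k).
    by apply: (@injective_unbounded (fun k => pickle (s, k))) => i j /(pcan_inj pickleK)[].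
  set r := pickle (s, k).
  have wdr : wd r = (n, nth v0 s).
    have -> : wd r = dec r by rewrite /wd /dec pickleK size_mkseq /= asboolT.
    by rewrite /dec pickleK size_mkseq.
  have [_ _ H _] := HS r.
  exists r; split => //.
  + move=> i le_in; rewrite (pE r.+1) ?H ?wdr //= ?sE //.
    by rewrite -tS wdr leq_add2l.
  + apply: ltnW; apply: leq_ltn_trans (St r.+1).
    by rewrite -tS wdr.
Qed.

Lemma forall_fin_max (T : finType) (P : T -> nat -> Prop) :
  (forall x, exists n0, forall n, n0 <= n -> P x n) ->
  exists n0, forall x n, n0 <= n -> P x n.
Proof.
move=> /choice[g Hg]; exists (\max_x g x) => x n le; apply: Hg.
exact: leq_trans (leq_bigmax x) le.
Qed.

Lemma walk_loop (V : Type) (e : V -> V -> Prop) (l : nat) (p : nat -> V) :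
  0 < l -> p 0 = p l -> walk e p l -> forall n, walk e (fun i => p (i %% l)) n.
Proof.
move=> l0 pl wp n i _; have lt := ltn_pmod i l0.
have -> : p (i.+1 %% l) = p (i %% l).+1.
  rewrite -addn1 -modnDml addn1.
  have [E|ne] := eqVneq (i %% l).+1 l; first by rewrite E modnn.
  by rewrite modn_small // ltn_neqAle ne.
exact: wp.
Qed.

(** [E] consists of the vertices met at infinitely many times [t r]. Each lies on a loop, and [M] is
    a common multiple of the loop lengths. Once [r >= M], the factorial forces [M] to divide [t r],
    so paths between late marked times have lengths divisible by [M] and can be padded by loops to
    one common length. *)
Lemma recurrent_words (V : finType) (e : V -> V -> Prop) (y : nat -> V) (t : nat -> nat) :
  (forall n, walk e y n) -> (forall r, t r < t r.+1) -> (forall r, r`! %| t r) ->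
  exists E K R, linked e E K /\
    forall r, R <= r -> exists n0, forall n, n0 <= n -> exists q,
      word e E K (n * K) q /\ forall i, i <= t r.+1 - t r -> q i = y (t r + i).
Proof.
move=> wy lt_t dt.
have mono r s : r < s -> t r < t s.
  elim: s => // s IH; rewrite ltnS leq_eqVlt => /orP[/eqP->//|/IH lt].
  exact: ltn_trans (lt_t s).
pose E u := forall R, exists2 r, R <= r & y (t r) = u.
have [R1 HR1] : exists R, forall u r, R <= r -> ~ E u -> y (t r) <> u.
  apply: forall_fin_max => u; have [Eu|nEu] := pselect (E u); first by exists 0.
  have [R HR] : exists R, forall r, R <= r -> y (t r) <> u.
    apply: contrapT => H; apply: nEu => R; apply: contrapT => H'.
    by apply: H; exists R => r Rr yu; apply: H'; exists r.
  by exists R => r Rr _; apply: HR.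
have ER r : R1 <= r -> E (y (t r)).
  by move=> Rr; apply: contrapT => nE; exact: (HR1 _ _ Rr nE).
have seg r s : r < s -> reach e (t s - t r) (y (t r)) (y (t s)).
  move=> rs; exists (fun i => y (t r + i)); split; rewrite ?addn0 //.
    by rewrite subnKC // ltnW // mono.
  by apply: walk_shift; apply: wy.
have /choice[l Hl] : forall u, exists l, 0 < l /\ (E u -> reach e l u u).
  move=> u; have [Eu|nEu] := pselect (E u); last by exists 1.
  have [r _ yr] := Eu 0; have [s rs ys] := Eu r.+1.
  exists (t s - t r); split; first by rewrite subn_gt0 mono.
  by move=> _; rewrite -{1}yr -{1}ys; apply: seg.
pose M := \prod_u l u.
have M0 : 0 < M by rewrite prodn_gt0 // => u; case: (Hl u).
have lM u : l u %| M by rewrite /M (bigD1 u) //= dvdn_mulr.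
pose R := maxn R1 M.
have dM r : R <= r -> M %| t r.
  rewrite geq_max => /andP[_ Mr]; apply: dvdn_trans (dt r).
  by rewrite dvdn_fact // M0.
have segM r s : R <= r -> r < s ->
    [/\ 0 < t s - t r, M %| t s - t r & t s = t r + (t s - t r)].
  move=> Rr rs; have lt := mono _ _ rs; split; first by rewrite subn_gt0.
    by rewrite dvdn_sub // dM // (leq_trans Rr) // ltnW.
  by rewrite subnKC // ltnW.
have ext b : E b -> exists q, [/\ forall n, walk e q n, q 0 = b & forall k, q (k * M) = b].
  move=> Eb; have [l0 /(_ Eb)[q [q0 ql wq]]] := Hl b.
  exists (fun i => q (i %% l b)); split; first by apply: walk_loop => //; rewrite q0 ql.
    by rewrite mod0n.
  by move=> k; have /eqP -> : k * M %% l b == 0 by exact: dvdn_mull.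
have extend k k' a b : E b -> k <= k' -> reach e (k * M) a b -> reach e (k' * M) a b.
  move=> Eb le; have [q [wq q0 qM]] := ext b Eb.
  rewrite -(subnKC le) mulnDl => rab; apply: (reach_add rab).
  by exists q; split.
have [k0 Hk0] : exists k0, forall (ab : V * V) n, k0 <= n -> E ab.1 -> E ab.2 ->
    reach e (n * M) ab.1 ab.2.
  apply: forall_fin_max => -[a b] /=.
  have [Ea|] := pselect (E a); last by exists 0.
  have [Eb|] := pselect (E b); last by exists 0.
  have [r Rr yr] := Ea R; have [s rs ys] := Eb r.+1.
  have [_ dd _] := segM _ _ Rr rs.
  exists ((t s - t r) %/ M) => n le _ _; apply: extend le _ => //.
  by rewrite divnK // -yr -ys; apply: seg.
exists E, (k0.+1 * M), R; split.
  split; first by rewrite muln_gt0.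
    by exists (y (t R1)); apply: ER.
  by move=> a b Ea Eb; apply: (Hk0 (a, b)).
move=> r Rr; have [T0 dT tE] := segM _ _ Rr (ltnSn r).
set T := t r.+1 - t r in T0 dT tE *.
have R1r : R1 <= r by apply: leq_trans Rr; rewrite leq_maxl.
have [q [wq q0 qM]] := ext _ (ER _ (leqW R1r)).
pose z i := y (t r + i).
have yq : z T = q 0 by rewrite q0 /z -tE.
(* After the marked segment, waiting on the loop [q] fills any large enough multiple of the common
   length. *)
exists T => n le.
have leT : T <= n * (k0.+1 * M) by rewrite (leq_trans le) // leq_pmulr // muln_gt0.
exists (join T z q); split; last by move=> i iT; rewrite (join_le yq).
split; last by rewrite dvdn_mull.
- by rewrite (join_le yq) // /z addn0; apply: ER.
- have -> : n * (k0.+1 * M) = T + (n * k0.+1 - T %/ M) * M.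
    by rewrite mulnBl divnK // -mulnA subnKC.
  by rewrite join_add qM; apply: ER; apply: leqW.
- rewrite -(subnKC leT); apply: walk_join => //.
  by apply: walk_shift; apply: wy.
Qed.

End Combinatorics.

(** * Compact metric spaces and densities *)

Section Metric.
Variables (R : realType) (X : Type) (d : X -> X -> R) (f : X -> X).
Hypotheses (dmet : is_metric d) (dcpt : mcompact d) (fcont : mcontinuous d f).

Lemma dist_refl x : d x x = 0.
Proof. by case: dmet => _ [/(_ x x)[_ ->]]. Qed.

Lemma dist_sym x y : d x y = d y x.
Proof. by case: dmet => _ [_ []]. Qed.

Lemma dist_triangle y x z : d x z <= d x y + d y z.
Proof. by case: dmet => _ [_ [_]]. Qed.

Lemma open_ball x r : mopen d [set y | d x y < r].
Proof.
move=> y /= xy; exists (r - d x y); first by rewrite subr_gt0.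
by move=> z yz; have := dist_triangle y x z; lra.
Qed.

Lemma finite_subcover (r : X -> R) : (forall x, 0 < r x) ->
  exists n (c : 'I_n -> X), forall x, exists i, d (c i) x < r (c i).
Proof.
move=> r0; have [|x|s Hs] := dcpt (I := X) (U := fun x => [set y | d x y < r x]).
- by move=> x; exact: open_ball.
- by exists x; rewrite /= dist_refl.
exists (size s), (tnth (in_tuple s)) => x; have [y [ys yx]] := Hs x.
suff [i iy] : exists i, tnth (in_tuple s) i = y by exists i; rewrite iy.
elim: s ys {Hs yx} => [//|z s IH] /= [zy|/IH[i iy]]; first by exists ord0.
by exists (lift ord0 i); rewrite -iy !(tnth_nth x).
Qed.

Lemma min_radius (T : finType) (g : T -> R) : (forall x, 0 < g x) ->
  exists2 r, 0 < r & forall x, r <= g x.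
Proof.
move=> g0; exists (\big[Num.min/1]_x g x).
  by elim/big_ind: _ => // x y x0 y0; rewrite lt_min x0.
by move=> x; rewrite (bigD1 x) //= ge_min lexx.
Qed.

Lemma finite_net (r : R) : 0 < r ->
  exists n (c : 'I_n -> X), forall x, exists i, d (c i) x < r.
Proof. by move=> r0; apply: (@finite_subcover (fun=> r)). Qed.

Lemma compact_unif_continuous (g : X -> X) (r : R) : mcontinuous d g -> 0 < r ->
  exists2 s, 0 < s & forall x y, d x y < s -> d (g x) (g y) < r.
Proof.
move=> gc r0; have r20 : 0 < r / 2 by lra.
have /choice[s Hs] : forall x, exists s, 0 < s /\
    forall y, d x y < s -> d (g x) (g y) < r / 2.
  by move=> x; have [s s0 Hs] := gc x _ r20; exists s.
have [|n [c Hc]] := @finite_subcover (fun x => s x / 2).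
  by move=> x; have [] := Hs x; lra.
have [|t t0 Ht] := @min_radius _ (fun i => s (c i) / 2).
  by move=> i; have [] := Hs (c i); lra.
exists t => // x y xy; have [i ci] := Hc x; have ti := Ht i.
have [s0 Hi] := Hs (c i).
have := dist_triangle x (c i) y => tr.
have h1 : d (g (c i)) (g x) < r / 2 by apply: Hi; lra.
have h2 : d (g (c i)) (g y) < r / 2 by apply: Hi; lra.
have := dist_triangle (g (c i)) (g x) (g y); rewrite (dist_sym (g x) (g (c i))).
by lra.
Qed.

Lemma iter_continuous n : mcontinuous d (iter n f).
Proof.
elim: n => [|n IH] x r r0; first by exists r.
have [s s0 Hs] := fcont (iter n f x) r0; have [t t0 Ht] := IH x s s0.
by exists t => // y xy /=; apply: Hs; apply: Ht.
Qed.

Lemma compact_unif_continuous_iter (N : nat) (r : R) : 0 < r ->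
  exists2 s, 0 < s & forall n x y, (n <= N)%N -> d x y < s ->
    d (iter n f x) (iter n f y) < r.
Proof.
move=> r0; have /choice[s Hs] : forall n, exists s, 0 < s /\
    forall x y, d x y < s -> d (iter n f x) (iter n f y) < r.
  by move=> n; have [s s0 Hs] := compact_unif_continuous (@iter_continuous n) r0; exists s.
have [|t t0 Ht] := @min_radius _ (fun i : 'I_N.+1 => s i); first by move=> i; case: (Hs i).
exists t => // n x y nN xy; have [_] := Hs n; apply; apply: lt_le_trans xy _.
exact: (Ht (Ordinal (nN : (n < N.+1)%N))).
Qed.

(** Otherwise each point has a ball that the sequence eventually avoids; finitely many of these
    cover [X], which leaves no place for a late term. *)
Lemma cluster_point (u : nat -> X) :
  exists x, forall r n, 0 < r -> exists2 k, (n <= k)%N & d x (u k) < r.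
Proof.
apply: contrapT => /forallNP H.
have /choice[g Hg] : forall x, exists g : R * nat,
    0 < g.1 /\ forall k, (g.2 <= k)%N -> ~ d x (u k) < g.1.
  move=> x; apply: contrapT => /forallNP H'; apply: (H x) => r n r0.
  apply: contrapT => H''; apply: (H' (r, n)); split => //= k nk du.
  by apply: H''; exists k.
have [|n [c Hc]] := @finite_subcover (fun x => (g x).1).
  by move=> x; have [] := Hg x.
pose N := (\max_i (g (c i)).2)%N.
have [i ci] := Hc (u N); have [_] := Hg (c i).
by move=> /(_ N); apply => //; exact: leq_bigmax.
Qed.

End Metric.

Section Density.
Variable R : realType.

Lemma limn_esup_ge (u : nat -> \bar R) (l : \bar R) :
  (forall N, exists2 n, (N <= n)%N & (l <= u n)%E) -> (l <= limn_esup u)%E.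
Proof.
move=> H; rewrite limn_esup_lim; apply: lime_ge; first exact: is_cvg_esups.
near=> N; have [n Nn ln] := H N.
by apply: le_trans ln _; apply: ereal_sup_ubound; exists n.
Unshelve. all: by end_near. Qed.

Lemma limn_esup_gt (u : nat -> \bar R) (l : \bar R) :
  (l < limn_esup u)%E -> forall N, exists2 n, (N <= n)%N & (l < u n)%E.
Proof.
move=> lu N; apply: contrapT => H.
suff : (limn_esup u <= l)%E by rewrite leNgt lu.
rewrite limn_esup_lim; apply: lime_le; first exact: is_cvg_esups.
near=> M; apply: ge_ereal_sup => _ [n /= Mn <-].
rewrite leNgt; apply/negP => lt; apply: H; exists n => //.
by apply: leq_trans Mn; near: M; exact: nbhs_infty_ge.
Unshelve. all: by end_near. Qed.

Lemma limn_esup_le (u : nat -> \bar R) (l : \bar R) :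
  (forall n, (u n <= l)%E) -> (limn_esup u <= l)%E.
Proof.
move=> H; rewrite leNgt; apply/negP => /limn_esup_gt /(_ 0%N)[n _].
by rewrite ltNge H.
Qed.

(** Such a block fills the proportion (j+1)/(j+2) of the first [j.+2 * s] times, and [j] is
    arbitrarily large. *)
Lemma upper_density_one_of_blocks (P : nat -> Prop) :
  (forall j0, exists j s, [/\ (j0 <= j)%N, (0 < s)%N &
     forall i, (i < j.+1 * s)%N -> P (s + i)%N]) ->
  upper_density_one R P.
Proof.
move=> H; apply/eqP; rewrite eq_le; apply/andP; split.
  apply: limn_esup_le => m; rewrite lee_fin.
  have [->|m0] := posnP m; first by rewrite invr0 mulr0.
  rewrite ler_pdivrMr ?ltr0n // mul1r ler_nat.
  by rewrite (leq_trans (max_card _)) // card_ord.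
apply/lee_addgt0Pr => e e0.
rewrite addeC -leeBlDl //; apply: limn_esup_ge => N.
have [j0 Hj0] : exists j0 : nat, (e * j0%:R > 1)%R.
  exists (Num.bound e^-1).
  by rewrite mulrC -ltr_pdivrMr // mul1r archi_boundP // invr_ge0 ltW.
(* [j >= j0] makes the missing proportion 1/(j+2) less than [e]; [j >= N] makes the window long
   enough. *)
have [j [s [j0j s0 HP]]] := H (maxn j0 N).
exists (j.+2 * s)%N.
  rewrite (leq_trans _ (leq_pmulr _ s0)) //.
  by rewrite (leq_trans (leq_trans (leq_maxr _ _) j0j)) // leqW // leqW.
rewrite -EFinB lee_fin.
have c : (j.+1 * s <= #|[set k : 'I_(j.+2 * s) | `[< P k >]]|)%N.
  have lt (i : 'I_(j.+1 * s)) : (s + i < j.+2 * s)%N by rewrite [X in (_ < X)%N]mulSn ltn_add2l.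
  have inj : injective (fun i => Ordinal (lt i)).
    by move=> i i' /(congr1 val) /= /addnI /val_inj.
  rewrite -[X in (X <= _)%N]card_ord -(card_imset _ inj) subset_leq_card //.
  apply/fintype.subsetP => k /imsetP[i _ ->]; apply: mem_set; apply/asboolP; exact: HP.
rewrite ler_pdivlMr ?ltr0n ?muln_gt0 //.
apply: le_trans (_ : (j.+1 * s)%:R <= _); last by rewrite ler_nat.
rewrite !natrM mulrA ler_pM2r ?ltr0n //.
have : (j0%:R <= j%:R :> R) by rewrite ler_nat (leq_trans (leq_maxl _ _) j0j).
rewrite -!natr1 => le; have : e * j0%:R <= e * j%:R by rewrite ler_pM2l.
have : 0 <= (j%:R : R) by rewrite ler0n.
by nra.
Qed.

End Density.

(** * Levels and liftings *)

(** A finite graph read in [X]: vertices, their points, the tolerance of an edge, the linked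
    vertices and their common linking length. *)
Record level (R : realType) (X : Type) := Level {
  lV : finType; lc : lV -> X; lD : R; lE : lV -> Prop; lK : nat }.

Section Levels.
Variables (R : realType) (X : Type) (d : X -> X -> R) (f : X -> X).
Hypotheses (dmet : is_metric d) (dcpt : mcompact d) (fcont : mcontinuous d f).

Definition edge (L : level R X) (u v : lV L) : Prop :=
  d (f (lc u)) (lc v) <= lD L.

Definition good_level (L : level R X) : Prop :=
  linked (@edge L) (@lE _ _ L) (lK L).

Definition lword (L : level R X) (n : nat) (w : nat -> X) : Prop :=
  exists p, word (@edge L) (@lE _ _ L) (lK L) n p /\ w = @lc _ _ L \o p.

(** The length [n'] depends on [n] alone, so that all words of a stage keep equal lengths and phases
    stay synchronous. *)
Definition lifts (L L' : level R X) (r : R) : Prop :=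
  forall n, exists n', (n <= n')%N /\ forall w, lword L n w ->
    exists w', lword L' n' w' /\ forall i, (i <= n)%N -> d (w i) (w' i) <= r.

Lemma lifts_trans L L' L'' r r' :
  lifts L L' r -> lifts L' L'' r' -> lifts L L'' (r + r').
Proof.
move=> H H' n; have [n' [nn' Hn]] := H n; have [n'' [nn'' Hn']] := H' n'.
exists n''; split; first exact: leq_trans nn''.
move=> w /Hn[w' [/Hn'[w'' [gw'' w'w'']] ww']]; exists w''; split => // i le_in.
have := ww' i le_in; have := w'w'' i (leq_trans le_in nn').
by have := dist_triangle dmet (w' i) (w i) (w'' i); lra.
Qed.

Lemma fine_net (r : R) : 0 < r -> exists2 s, 0 < s & forall x y x' y',
  d x x' < s -> d y y' < s -> y = f x -> d (f x') y' <= r.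
Proof.
move=> r0; have r20 : 0 < r / 2 by lra.
have [s s0 Hs] := compact_unif_continuous dmet dcpt fcont r20.
exists (Num.min s (r / 2)); first by rewrite lt_min s0.
move=> x y x' y'; rewrite !lt_min => /andP[xs _] /andP[_ ys] E.
have := Hs _ _ xs; have := dist_triangle dmet (f x) (f x') y'.
by rewrite (dist_sym dmet (f x') (f x)) -E; lra.
Qed.

(* A real orbit shadowing the universal walk of L is read through a fine net;
   the net points it visits infinitely often at the marked times form the next level. *)
Lemma lift_level (L : level R X) (eps delta : R) : 0 < eps -> 0 < delta ->
  good_level L ->
  (forall xs, pseudo_orbit d f (lD L) xs -> exists x, shadowed d f eps xs x) ->
  exists L', [/\ lD L' = delta, good_level L' & lifts L L' (2 * eps)].
Proof.
move=> eps0 delta0 gL shL.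
have [p [t [wp lt_t dt Hp]]] := universal_walk gL.
have [|x Hx] := shL (@lc _ _ L \o p); first by move=> i; exact: (wp i.+1 i).
have [s s0 Hs] := fine_net delta0.
(* Mesh [s] makes the readings edges of tolerance [delta]; mesh [eps] adds at most [eps] to the
   shadowing error [eps]. *)
have [|N [c Hc]] := @finite_net R X d dmet dcpt (Num.min s eps).
  by rewrite lt_min s0.
have /choice[y Hy] : forall i, exists u, d (c u) (iter i f x) < Num.min s eps.
  by move=> i; apply: Hc.
pose e (u v : 'I_N) := d (f (c u)) (c v) <= delta.
have wy n : walk e y n.
  move=> i _; apply: (Hs (iter i f x) (iter i.+1 f x)) => //.
    by have := Hy i; rewrite dist_sym // lt_min => /andP[].
  by have := Hy i.+1; rewrite dist_sym // lt_min => /andP[].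
have [E [K [R0 [lk HR]]]] := recurrent_words wy lt_t dt.
exists (Level c delta E K); split=> // n.
(* Encoded as finite functions, the words of length [n] are finitely many, so one threshold [n0]
   serves them all. *)
pose wd (g : {ffun 'I_n.+1 -> lV L}) := fun i => g (inord i).
have [n0 Hn0] : exists n0, forall (g : {ffun 'I_n.+1 -> lV L}) m, (n0 <= m)%N ->
    word (@edge L) (@lE _ _ L) (lK L) n (wd g) ->
    exists q, word e E K (m * K) q /\
      forall i, (i <= n)%N -> d (lc (wd g i)) (c (q i)) <= 2 * eps.
  apply: forall_fin_max => g.
  have [gw|ngw] := pselect (word (@edge L) (@lE _ _ L) (lK L) n (wd g)); last by exists 0%N.
  have [r [Rr pr tr]] := Hp _ _ gw R0; have [m0 Hm0] := HR _ Rr.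
  exists m0 => m /Hm0[q [gq Hq]] _; exists q; split => // i le_in.
  rewrite Hq; last by rewrite (leq_trans le_in) // leq_subRL // ltnW.
  have := Hx (t r + i)%N; rewrite /= pr // => h1.
  have := Hy (t r + i)%N; rewrite lt_min dist_sym // => /andP[_ h2].
  have := dist_triangle dmet (iter (t r + i) f x) (lc (wd g i)) (c (y (t r + i)%N)).
  by rewrite (dist_sym dmet (lc (wd g i)) (iter _ _ _)); lra.
have [K0 _ _] := lk.
exists (maxn n0 n * K)%N; split.
  by rewrite (leq_trans (leq_maxr n0 n)) // leq_pmulr.
move=> w [q [gq ->]].
pose g : {ffun 'I_n.+1 -> lV L} := [ffun i : 'I_n.+1 => q i].
have gE i : (i <= n)%N -> wd g i = q i by move=> le; rewrite /wd ffunE inordK.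
have [q' [gq' Hq']] := Hn0 g _ (leq_maxl n0 n) (word_ext gE gq).
exists (c \o q'); split; first by exists q'.
by move=> i le /=; rewrite -gE //; apply: Hq'.
Qed.

(** * Separated loops from positive entropy *)

Lemma expn_lt_expR (r : R) (D : nat) : 0 < r ->
  exists N, forall n, (N <= n)%N -> (n.+1 ^ D)%:R <= expR (r * n%:R).
Proof.
(* With [z = r * n / k], large [n] gives n <= z^2, hence n+1 <= (1+z)^2, and [1 + z <= expR z]
   concludes. Using [D.+1] keeps [k] positive. *)
move=> r0; pose k : R := 2 * D.+1%:R.
have k0 : 0 < k by rewrite mulr_gt0.
exists (Num.bound (k ^+ 2 / r ^+ 2)) => n leN.
have Hn : k ^+ 2 <= r ^+ 2 * n%:R.
  rewrite mulrC -ler_pdivrMr ?exprn_gt0 //.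
  apply: le_trans (ltW (archi_boundP _)) _; first by rewrite divr_ge0 // exprn_ge0 // ltW.
  by rewrite ler_nat.
pose z := r * n%:R / k.
have z0 : 0 <= z by rewrite !mulr_ge0 ?invr_ge0 // ltW.
have zE : r * n%:R = D.+1%:R * (2%:R * z).
  by rewrite mulrA (mulrC D.+1%:R) -/k /z [RHS]mulrC divfK // gt_eqF.
have : (n.+1%:R : R) <= (1 + z) ^+ 2.
  have : n%:R <= z ^+ 2.
    have zk : z * k = r * n%:R by rewrite divfK // gt_eqF.
    rewrite -(ler_pM2l (exprn_gt0 2 k0)) -exprMn (mulrC k) zk.
    by apply: le_trans (ler_wpM2r (ler0n _ n) Hn) _; rewrite exprMn -mulrA -expr2.
  by rewrite -natr1; nra.
move=> le; apply: le_trans (_ : n.+1%:R ^+ D.+1 <= _).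
  by rewrite -natrX ler_nat leq_pexp2l.
rewrite zE !expRM_natl lerXn2r ?nnegrE ?exprn_ge0 ?expR_ge0 //.
apply: le_trans le _; rewrite lerXn2r ?nnegrE ?expR_ge0 ?addr_ge0 //.
exact: expR_ge1Dx.
Qed.

Lemma exists_fin_lt (x : \bar R) : (0 < x)%E -> exists2 r : R, 0 < r & (r%:E < x)%E.
Proof.
case: x => [x| |//]; last by exists 1; rewrite ?ltry.
by rewrite lte_fin => x0; exists (x / 2); rewrite ?lte_fin; lra.
Qed.

(** At most (n^2+1)^N tables [F] exist, polynomially many in [n], whereas separated sets grow
    exponentially. *)
Lemma first_last_visit (N n : nat) (y : nat -> 'I_N) :
  exists F : {ffun 'I_N -> option ('I_n * 'I_n)}, forall u,
    if F u is Some (a, b) then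
      [/\ y a = u, y b = u & forall k, (k < n)%N -> y k = u -> (a <= k <= b)%N]
    else forall k, (k < n)%N -> y k <> u.
Proof.
pose P u (ab : option ('I_n * 'I_n)) :=
  if ab is Some (a, b) then
    [/\ y a = u, y b = u & forall k, (k < n)%N -> y k = u -> (a <= k <= b)%N]
  else forall k, (k < n)%N -> y k <> u.
suff /choice[F HF] : forall u, exists ab, P u ab.
  by exists [ffun u => F u] => u; rewrite ffunE; apply: HF.
move=> u; have [[k kn yk]|no] := pselect (exists2 k, (k < n)%N & y k = u); last first.
  by exists None => k kn yk; apply: no; exists k.
pose Q (i : 'I_n) := y i == u.
have Qk : Q (Ordinal kn) by apply/eqP.
exists (Some ([arg min_(i < Ordinal kn | Q i) i]%N, [arg max_(i > Ordinal kn | Q i) i]%N)).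
rewrite /P; case: arg_minnP => // a /eqP ya amin; case: arg_maxnP => // b /eqP yb bmax.
split => // l ln yl; have Ql : Q (Ordinal ln) by apply/eqP.
by apply/andP; split; [apply: (amin _ Ql) | apply: (bmax _ Ql)].
Qed.

(* Two points of a large separated set with the same first and last visit times
   to every cell give, at the cell visited when they separate, two loops of the
   same length. *)
Lemma entropy_level : (exists x : X, True) -> (0 < htop d f)%E ->
  exists2 es : R, 0 < es & forall delta, 0 < delta ->
    exists (L : level R X) v a b k, [/\ lD L = delta, @lE _ _ L = eq v,
      [/\ a 0%N = v, a (lK L) = v & walk (@edge L) a (lK L)],
      [/\ b 0%N = v, b (lK L) = v & walk (@edge L) b (lK L)] &
      (k < lK L)%N /\ es < d (lc (a k)) (lc (b k))].
Proof.
move=> [x0 _] /ereal_sup_gt[_ [e /= e0 <-]] /exists_fin_lt[r r0 Hr].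
(* Replacing two points by net points within [e / 4] costs at most half of the separation [e]. *)
exists (e / 2); first by lra.
move=> delta delta0; have [s s0 Hs] := fine_net delta0.
have [|N [c Hc]] := @finite_net R X d dmet dcpt (Num.min s (e / 4)).
  by rewrite lt_min s0 /=; lra.
have /choice[idx Hidx] : forall x, exists u, d x (c u) < Num.min s (e / 4).
  by move=> x; have [u] := Hc x; rewrite dist_sym //; exists u.
pose eg (u v : 'I_N) := d (f (c u)) (c v) <= delta.
have wy x n m : walk eg (fun i => idx (iter (m + i) f x)) n.
  move=> i _; apply: (Hs (iter (m + i) f x) (iter (m + i.+1) f x)).
  - by have := Hidx (iter (m + i) f x); rewrite lt_min => /andP[].
  - by have := Hidx (iter (m + i.+1) f x); rewrite lt_min => /andP[].
  - by rewrite addnS.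
(* The exponent comes from (n^2+1)^N <= (n+1)^(2N), a bound for the number of visit tables. *)
have [n0 Hn0] := @expn_lt_expR r (2 * N) r0.
have [n n0n] := limn_esup_gt Hr (maxn 1 n0).
move: n0n; rewrite geq_max => /andP[n1 n0n].
move=> /ereal_sup_gt[_ [m [x [m0 [_ sep] ->]]]].
rewrite lte_fin ltr_pdivlMr ?ltr0n // => rm.
have card : ((n.+1 ^ (2 * N)) < m)%N.
  rewrite -(ltr_nat R); apply: le_lt_trans (Hn0 _ n0n) _.
  by rewrite -(@lnK _ m%:R) ?posrE ?ltr0n // ltr_expR.
have /choice[F HF] := fun i => @first_last_visit N n (fun k => idx (iter k f (x i))).
have [i [j [ij Fij]]] : exists i j, i != j /\ F i = F j.
  apply: contrapT => H; have inj : injective F.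
    move=> i j Fij; apply/eqP; apply: contrapT => /negP ij.
    by apply: H; exists i, j.
  have := leq_card F inj.
  rewrite card_ord card_ffun card_option card_prod !card_ord leqNgt => /negP; apply.
  apply: leq_ltn_trans card; rewrite expnM.
  have le1 : ((n * n).+1 <= n.+1 ^ 2)%N by rewrite -mulnn mulnS mulSn; lia.
  by case: (N) => // N'; rewrite leq_exp2r.
have [k kn ek] := sep _ _ ij.
have idxD u : d u (c (idx u)) < e / 4 by have := Hidx u; rewrite lt_min => /andP[].
have far : e / 2 < d (c (idx (iter k f (x i)))) (c (idx (iter k f (x j)))).
  have := idxD (iter k f (x i)); have := idxD (iter k f (x j)).
  have := dist_triangle dmet (c (idx (iter k f (x i)))) (iter k f (x i)) (iter k f (x j)).
  have := dist_triangle dmet (c (idx (iter k f (x j)))) (c (idx (iter k f (x i)))) (iter k f (x j)).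
  by rewrite (dist_sym dmet (c (idx (iter k f (x j)))) (iter k f (x j))); lra.
(* The cell of one orbit at the separation time [k]. As [F i = F j], both orbits are in [v] at the
   same times [a] and [b] around [k]. *)
pose v := idx (iter k f (x i)).
have := HF i v; have := HF j v; rewrite -Fij.
case: (F i v) => [[a b]|]; last by move=> _ /(_ k kn).
move=> [aj bj _] [ai bi /(_ k kn erefl) /andP[ak kb]].
exists (Level c delta (eq v) (b - a)%N), v.
exists (fun l => idx (iter (a + l) f (x i))), (fun l => idx (iter (a + l) f (x j))).
exists (k - a)%N => /=; have ab := leq_trans ak kb.
split => //; first by rewrite addn0 subnKC //; split.
  by rewrite addn0 subnKC //; split.
(* Neither [a = b] nor [k = b] is possible: both orbits would be read at [v] at time [k], against
   [far]. *)
rewrite subnKC //; split => //; apply: ltn_sub2r.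
  rewrite ltn_neqAle ab andbT; apply/eqP => E.
  have kE : k = a by apply/eqP; rewrite eqn_leq ak E kb.
  by move: far; rewrite kE ai aj dist_refl //; lra.
rewrite ltn_neqAle kb andbT; apply/eqP => E.
by move: far; rewrite E bi bj dist_refl //; lra.
Qed.
End Levels.

(** * Stages *)

Section Stages.
Variables (R : realType) (X : Type) (d : X -> X -> R) (f : X -> X).
Hypotheses (dmet : is_metric d) (dcpt : mcompact d) (fcont : mcontinuous d f).

(* Points without a listed prefix get the symbol size C, whence the modulus (size C).+1
   in the phases. *)
Definition symbol (C : seq (seq bool)) (s : nat -> bool) : nat :=
  find (fun l => l == mkseq s (size l)) C.

Lemma symbol_lt C s : (symbol C s < (size C).+1)%N.
Proof. exact: find_size. Qed.

Lemma symbol_finite C : exists B, forall s s',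
  (forall i, (i < B)%N -> s i = s' i) -> symbol C s = symbol C s'.
Proof.
exists (\max_(l <- C) size l)%N => s s' ss'.
apply: eq_in_find => l lC; congr (_ == _); apply/eq_in_map => i.
rewrite mem_iota add0n => /= il; apply: ss'; apply: leq_trans il _.
exact: leq_bigmax_seq.
Qed.

Variables (L0 : level R X) (v : lV L0) (a b : nat -> lV L0) (k0 : nat).
Local Notation K0 := (lK L0).
Hypotheses (E0 : @lE _ _ L0 = eq v) (k0K0 : (k0 < K0)%N).
Hypotheses (a0 : a 0%N = v) (aK : a K0 = v) (wa : walk (@edge _ _ d f L0) a K0).
Hypotheses (b0 : b 0%N = v) (bK : b K0 = v) (wb : walk (@edge _ _ d f L0) b K0).

(* The loop b occurs only in the blocks congruent to q modulo N, so distinct symbols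
   below N are separated once in every N consecutive blocks. *)
Definition pattern (q N : nat) : nat -> X :=
  fun i => lc (if (i %/ K0) %% N == q then b (i %% K0) else a (i %% K0))%N.

Lemma base_good : good_level d f L0.
Proof.
split; first exact: leq_ltn_trans k0K0.
  by exists v; rewrite E0.
by move=> x y; rewrite E0 => <- <-; exists a.
Qed.

Lemma pattern_word q N H : lword d f L0 (H * K0) (pattern q N).
Proof.
have K00 : (0 < K0)%N by apply: leq_ltn_trans k0K0.
pose p (i : nat) : lV L0 := if (i %/ K0 %% N)%N == q then b (i %% K0)%N else a (i %% K0)%N.
have pM h : p (h * K0)%N = v by rewrite /p modnMl a0 b0 if_same.
exists p; split => //; split.
- by rewrite E0 -(mul0n K0) pM.
- by rewrite E0 pM.
- move=> i _; have lt := ltn_pmod i K00.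
  have -> : p i.+1 = if (i %/ K0 %% N)%N == q then b (i %% K0).+1 else a (i %% K0).+1.
    (* At the end of a block both loops are back at [v], so the loop may change there. *)
    have [E|ne] := eqVneq (i %% K0).+1 K0.
      rewrite E aK bK if_same {1}(divn_eq i K0) -addnS E -mulSnr.
      exact: pM.
    have lt' : ((i %% K0).+1 < K0)%N by rewrite ltn_neqAle ne.
    have iE : i.+1 = (i %/ K0 * K0 + (i %% K0).+1)%N by rewrite addnS -divn_eq.
    have di : (i.+1 %/ K0 = i %/ K0)%N by rewrite {1}iE divnMDl // (divn_small lt') addn0.
    have mi : (i.+1 %% K0 = (i %% K0).+1)%N by rewrite {1}iE modnMDl modn_small.
    by rewrite /p di mi.
  by rewrite /p; case: ifP => _; [apply: wb | apply: wa].
- exact: dvdn_mull.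
Qed.

(** Finishing the current block and waiting for the next one congruent to [q] takes at most [N]
    blocks; position [k0] in it then shows [b] on one side and [a] on the other. *)
Lemma pattern_sep q q' N (i : nat) : (q < N)%N -> (q' < N)%N -> q != q' ->
  exists t, [/\ (t <= N.+1 * K0)%N, pattern q N (i + t) = lc (b k0) &
    pattern q' N (i + t) = lc (a k0)].
Proof.
move=> qN q'N qq'; have K00 : (0 < K0)%N by apply: leq_ltn_trans k0K0.
pose B := (i %/ K0).+1.
pose B' := (B + (q + (N - B %% N)) %% N)%N.
have BN : (B %% N < N)%N by rewrite ltn_mod (leq_ltn_trans _ qN).
have B'q : (B' %% N = q)%N.
  rewrite /B' modnDmr addnCA -modnDmr -(modnDml B) subnKC; last exact: ltnW.
  by rewrite modnn addn0 modn_small.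
have lt : (i < B * K0)%N by rewrite /B; apply: ltn_ceil.
have BB' : (B * K0 <= B' * K0)%N by rewrite leq_mul2r leq_addr orbT.
have iB' : (i <= B' * K0 + k0)%N.
  by rewrite (leq_trans (ltnW lt)) // (leq_trans BB') // leq_addr.
exists (B' * K0 + k0 - i)%N; split.
- have h1 : ((q + (N - B %% N)) %% N < N)%N by rewrite ltn_mod (leq_ltn_trans _ qN).
  have h2 : (B' * K0 <= (i %/ K0 + N) * K0)%N.
    by rewrite leq_mul2r /B' /B addSnnS leq_add2l h1 orbT.
  have h3 : ((i %/ K0) * K0 <= i)%N by exact: leq_trunc_div.
  rewrite leq_subLR; move: h2; rewrite mulnDl mulSn; lia.
- rewrite subnKC // /pattern divnMDl // divn_small // addn0 B'q eqxx.
  by rewrite modnMDl modn_small.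
- rewrite subnKC // /pattern divnMDl // divn_small // addn0 B'q (negbTE qq').
  by rewrite modnMDl modn_small.
Qed.

(** [j.+1 * tau] is the block needed for upper density one; the rest is the waiting time of
    [pattern_sep] for modulus [(size C).+1], so a separation sought from inside the block still
    falls in the phase. *)
Definition phase_length (C : seq (seq bool)) (j tau : nat) : nat :=
  (j.+1 * tau + (size C).+2 * K0)%N.

(** The new word is a lift of [W s], then a linking path, then a lift of the pattern of the symbol
    of [s]. *)
Lemma stage_step (L L' : level R X) (r r0 : R) (T j : nat)
    (W : (nat -> bool) -> nat -> X) (C : seq (seq bool)) :
  good_level d f L' -> lifts d f L L' r -> lifts d f L0 L' r0 ->
  (forall s, lword d f L T (W s)) ->
  exists T' W' tau, [/\ forall s, lword d f L' T' (W' s),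
    forall s s', W s = W s' -> symbol C s = symbol C s' -> W' s = W' s',
    forall s i, (i <= T)%N -> d (W s i) (W' s i) <= r,
    [/\ (0 < tau)%N, (T <= tau)%N & (tau + phase_length C j tau <= T')%N] &
    (forall s s' i, symbol C s = symbol C s' -> (i <= phase_length C j tau)%N ->
      W' s (tau + i)%N = W' s' (tau + i)%N) /\
    (forall s i, (i <= phase_length C j tau)%N ->
      d (W' s (tau + i)%N) (pattern (symbol C s) (size C).+1 i) <= r0)].
Proof.
move=> gL' LL' L0L' gW; have K00 : (0 < K0)%N by apply: leq_ltn_trans k0K0.
have [n1 [Tn1 H1]] := LL' T.
(* Lifts are chosen per word, not per [s], so that [W' s] depends only on [W s] and the symbol; this
   later gives continuity. *)
have /choice[F HF] : forall w, exists w', lword d f L T w ->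
    lword d f L' n1 w' /\ forall i, (i <= T)%N -> d (w i) (w' i) <= r.
  move=> w; have [gw|ng] := pselect (lword d f L T w); last by exists w.
  by have [w' Hw'] := H1 _ gw; exists w'.
have K'0 : (0 < lK L')%N by case: gL'.
pose tau := (n1 + lK L')%N.
have tau0 : (0 < tau)%N by rewrite addn_gt0 K'0 orbT.
pose H := phase_length C j tau.
have leH : (H <= H * K0)%N by rewrite leq_pmulr.
(* Patterns are words only at multiples of [K0], hence [H * K0] in place of [H]. *)
have [n2 [Hn2 H2]] := L0L' (H * K0)%N.
have /choice[G HG] := fun q => H2 _ (pattern_word q (size C).+1 H).
have /choice[J HJ] : forall ww : (nat -> X) * (nat -> X), exists w,
    lword d f L' n1 ww.1 -> lword d f L' n2 ww.2 ->
    [/\ lword d f L' (tau + n2) w, forall i, (i <= n1)%N -> w i = ww.1 i &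
      forall i, w (tau + i)%N = ww.2 i].
  move=> [w w'] /=; have [[p [gp ->]]|] := pselect (lword d f L' n1 w); last by exists w.
  have [[p' [gp' ->]]|] := pselect (lword d f L' n2 w'); last by exists w.
  have [q [gq qp qp']] := word_link gL' gp gp'.
  exists (@lc _ _ L' \o q) => _ _; split.
  - by exists q.
  - by move=> i le /=; rewrite qp.
  - by move=> i /=; rewrite qp'.
pose W' s := J (F (W s), G (symbol C s)).
have HW s : [/\ lword d f L' (tau + n2) (W' s),
    forall i, (i <= n1)%N -> W' s i = F (W s) i &
    forall i, W' s (tau + i)%N = G (symbol C s) i].
  exact: (HJ (F (W s), G (symbol C s)) (HF _ (gW s)).1 (HG (symbol C s)).1).
exists (tau + n2)%N, W', tau; split.
- by move=> s; case: (HW s).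
- by rewrite /W' => s s' -> ->.
- move=> s i iT; have [_ Wl _] := HW s; rewrite (Wl _ (leq_trans iT Tn1)).
  exact: (HF _ (gW s)).2.
- split => //; first by rewrite (leq_trans Tn1) // leq_addr.
  by rewrite leq_add2l (leq_trans leH).
- split.
    move=> s s' i E _; have [_ _ ->] := HW s; have [_ _ ->] := HW s'.
    by rewrite /= E.
  move=> s i iH; have [_ _ -> /=] := HW s; rewrite dist_sym //.
  by apply: (HG (symbol C s)).2; apply: leq_trans leH.
Qed.

(** * Levels with summable errors, and limit points *)

Variables (e0 : R).
Hypotheses (shad : shadowing d f) (e00 : 0 < e0).

Definition shadows (L : level R X) (r : R) : Prop :=
  forall xs, pseudo_orbit d f (lD L) xs -> exists x, shadowed d f r xs x.

Hypothesis shad0 : shadows L0 e0.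

Definition eps (j : nat) : R := e0 / 2 ^+ j.

Lemma eps_gt0 j : 0 < eps j.
Proof. by rewrite divr_gt0 // exprn_gt0. Qed.

Lemma epsS j : eps j = 2 * eps j.+1.
Proof. by rewrite /eps exprS invfM [RHS]mulrCA mulVKf // pnatr_eq0. Qed.

Lemma eps_le_e0 j : eps j <= e0.
Proof.
elim: j => [|j IH]; first by rewrite /eps expr0 divr1.
by have := epsS j; have := eps_gt0 j.+1; lra.
Qed.

Lemma eps_small r : 0 < r -> exists J, forall j, (J <= j)%N -> eps j < r.
Proof.
move=> r0; exists (Num.bound (e0 / r)) => j Jj.
rewrite /eps ltr_pdivrMr ?exprn_gt0 // mulrC -ltr_pdivrMr //.
apply: lt_le_trans (archi_boundP _) _; first by rewrite divr_ge0 // ltW.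
by rewrite -natrX ler_nat (leq_trans Jj) // ltnW // ltn_expl.
Qed.

(** A linking path has positive length, so some edge exists and its distance bounds [lD] from below.
    Thus steps of a true orbit are within tolerance. *)
Lemma good_level_ge0 L : good_level d f L -> 0 <= lD L.
Proof.
move=> [K1 [u Eu] /(_ u u Eu Eu)[p [_ _ wp]]].
by apply: le_trans (wp 0%N K1); case: dmet => + _; apply.
Qed.

(** Shadowing at [eps j.+1] supplies the tolerance of level [j.+1], and the lift to it uses
    shadowing at [eps j] on level [j]. *)
Lemma level_sequence : exists Ls : nat -> level R X, forall j,
  [/\ good_level d f (Ls j), shadows (Ls j) (eps j),
      lifts d f (Ls j) (Ls j.+1) (2 * eps j) & lifts d f L0 (Ls j) (4 * e0)].
Proof.
have /choice[F HF] : forall jL : nat * level R X, exists L',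
    good_level d f jL.2 -> shadows jL.2 (eps jL.1) ->
    [/\ good_level d f L', shadows L' (eps jL.1.+1) &
      lifts d f jL.2 L' (2 * eps jL.1)].
  move=> [j L] /=; have [gL|] := pselect (good_level d f L); last by exists L.
  have [sL|] := pselect (shadows L (eps j)); last by exists L.
  have [delta delta0 Hd] := shad (eps_gt0 j.+1).
  have [L' [DL' gL' LL']] := lift_level dmet dcpt fcont (eps_gt0 j) delta0 gL sL.
  by exists L' => _ _; split => // xs; rewrite DL'; apply: Hd.
pose Ls := fix Ls j := if j is j'.+1 then F (j', Ls j') else L0.
have base j : good_level d f (Ls j) /\ shadows (Ls j) (eps j).
  elim: j => [|j [gj sj]].
    by split; [exact: base_good | move=> xs; rewrite /eps expr0 divr1; apply: shad0].
  by have [] := HF (j, Ls j) gj sj.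
have step j : lifts d f (Ls j) (Ls j.+1) (2 * eps j).
  by have [gj sj] := base j; have [] := HF (j, Ls j) gj sj.
(* The sharper bound telescopes, since [2 * eps j = 4 * eps j - 4 * eps j.+1]. *)
have far j : lifts d f L0 (Ls j) (4 * e0 - 4 * eps j).
  elim: j => [|j IH].
    move=> n; exists n; split=> // w gw; exists w; split=> // i _.
    by rewrite dist_refl // /eps expr0 divr1 subrr.
  have := lifts_trans dmet IH (step j); congr (lifts _ _ _ _ _).
  by rewrite (epsS j); lra.
exists Ls => j; have [gj sj] := base j; split=> // n.
have [n' [nn' Hn]] := far j n; exists n'; split => // w /Hn[w' [gw' Hw']].
exists w'; split => // i le; have := Hw' i le; have := eps_gt0 j; lra.
Qed.

Lemma stages (C : nat -> seq (seq bool)) :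
  exists (T : nat -> nat) (W : nat -> (nat -> bool) -> nat -> X) (tau : nat -> nat),
  [/\ forall j s, exists x, forall i, (i <= T j)%N -> d (iter i f x) (W j s i) <= eps j,
    forall j s i, (i <= T j)%N -> d (W j s i) (W j.+1 s i) <= 2 * eps j,
    forall j, exists B, forall s s', (forall i, (i < B)%N -> s i = s' i) -> W j s = W j s',
    forall j, [/\ (0 < tau j)%N, (T j <= tau j)%N &
      (tau j + phase_length (C j) j (tau j) <= T j.+1)%N] &
    forall j,
      (forall s s' i, symbol (C j) s = symbol (C j) s' ->
        (i <= phase_length (C j) j (tau j))%N ->
        W j.+1 s (tau j + i)%N = W j.+1 s' (tau j + i)%N) /\
      (forall s i, (i <= phase_length (C j) j (tau j))%N ->
        d (W j.+1 s (tau j + i)%N) (pattern (symbol (C j) s) (size (C j)).+1 i) <= 4 * e0)].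
Proof.
have [Ls HLs] := level_sequence.
pose state := (nat * nat * ((nat -> bool) -> nat -> X))%type.
pose good j (z : state) := forall s, lword d f (Ls j) z.1.1 (z.2 s).
pose next j (z z' : state) := [/\ good j.+1 z',
    forall s s', z.2 s = z.2 s' -> symbol (C j) s = symbol (C j) s' -> z'.2 s = z'.2 s',
    forall s i, (i <= z.1.1)%N -> d (z.2 s i) (z'.2 s i) <= 2 * eps j,
    [/\ (0 < z'.1.2)%N, (z.1.1 <= z'.1.2)%N &
      (z'.1.2 + phase_length (C j) j z'.1.2 <= z'.1.1)%N] &
    (forall s s' i, symbol (C j) s = symbol (C j) s' ->
        (i <= phase_length (C j) j z'.1.2)%N ->
        z'.2 s (z'.1.2 + i)%N = z'.2 s' (z'.1.2 + i)%N) /\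
    (forall s i, (i <= phase_length (C j) j z'.1.2)%N ->
        d (z'.2 s (z'.1.2 + i)%N) (pattern (symbol (C j) s) (size (C j)).+1 i) <= 4 * e0)].
have /choice[F HF] : forall jz : nat * state, exists z',
    good jz.1 jz.2 -> next jz.1 jz.2 z'.
  move=> [j [[T t] W]] /=; have [gW|] := pselect (good j (T, t, W)); last by exists (T, t, W).
  have [_ _ LL' _] := HLs j; have [gL' _ _ L0L'] := HLs j.+1.
  have [T' [W' [tau H]]] := stage_step j (C j) gL' LL' L0L' gW.
  by exists (T', tau, W').
have [[_ [u Eu] _] _ _ _] := HLs 0%N.
pose S := fix S j : state :=
  if j is j'.+1 then F (j', S j') else (0, 0, fun _ _ => lc u)%N.
have gS j : good j (S j).
  elim: j => [|j IH]; last by have [] := HF (j, S j) IH.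
  by move=> s; exists (fun=> u).
have nS j : next j (S j) (S j.+1) := HF (j, S j) (gS j).
exists (fun j => (S j).1.1), (fun j => (S j).2), (fun j => (S j.+1).1.2); split.
- move=> j s; have [p [[_ _ wp _] Ep]] := gS j s; have [gj sh _ _] := HLs j.
  set T := (S j).1.1 in wp *; set w := (S j).2 s in Ep *.
  (* The word is continued by the true orbit of its last point, to obtain an infinite pseudo
     orbit. *)
  pose q i := iter i f (w T).
  have wq : w T = q 0%N by [].
  have [|x Hx] := sh (join T w q).
    have ww : walk (fun x y => d (f x) y <= lD (Ls j)) w T.
      by move=> i iT; rewrite Ep; apply: wp.
    have wkq n : walk (fun x y => d (f x) y <= lD (Ls j)) q n.
      move=> i _; by rewrite /q /= dist_refl // (good_level_ge0 gj).
    move=> i; apply: (walk_join wq ww (wkq i.+1)).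
    by rewrite addnS ltnS leq_addl.
  by exists x => i iT; have := Hx i; rewrite (join_le wq).
- by move=> j s i; have [_ _ H _ _] := nS j; apply: H.
- elim=> [|j [B HB]]; first by exists 0%N.
  have [_ H _ _ _] := nS j; have [B' HB'] := symbol_finite (C j).
  exists (maxn B B') => s s' ss'; apply: H.
    by apply: HB => i iB; apply: ss'; rewrite leq_max iB.
  by apply: HB' => i iB; apply: ss'; rewrite leq_max iB orbT.
- by move=> j; have [_ _ _ H _] := nS j.
- by move=> j; have [_ _ _ _ H] := nS j.
Qed.

(** [g s] is a cluster point of points shadowing the words [W j s]. Up to time [T j] the error is
    made of [eps j] from continuity, [eps k] from shadowing a later word, and less than [4 * eps j]
    from the lifts in between. *)
Lemma limit_points (T : nat -> nat) (W : nat -> (nat -> bool) -> nat -> X) :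
  (forall j s, exists x, forall i, (i <= T j)%N -> d (iter i f x) (W j s i) <= eps j) ->
  (forall j s i, (i <= T j)%N -> d (W j s i) (W j.+1 s i) <= 2 * eps j) ->
  (forall j, (T j <= T j.+1)%N) ->
  exists g : (nat -> bool) -> X, forall j s i, (i <= T j)%N ->
    d (iter i f (g s)) (W j s i) < 6 * eps j.
Proof.
move=> HW WW leT.
suff /choice[g Hg] : forall s, exists x, forall j i, (i <= T j)%N ->
    d (iter i f x) (W j s i) < 6 * eps j.
  by exists g => j s i; apply: Hg.
move=> s; have /choice[u Hu] := fun j => HW j s.
have Tm j k : (T j <= T (j + k))%N.
  by elim: k => [|k IH]; rewrite ?addn0 // addnS (leq_trans IH).
have far j k i : (i <= T j)%N ->
    d (W j s i) (W (j + k)%N s i) <= 4 * eps j - 4 * eps (j + k).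
  move=> iT; elim: k => [|k IH]; first by rewrite addn0 dist_refl // subrr.
  have := dist_triangle dmet (W (j + k)%N s i) (W j s i) (W (j + k.+1)%N s i).
  have := WW (j + k)%N s i (leq_trans iT (Tm j k)).
  by rewrite addnS; have := epsS (j + k)%N; lra.
have [x Hx] := cluster_point dmet dcpt u.
exists x => j i iT.
have [r r0 Hr] := iter_continuous fcont i x (eps_gt0 j).
have [k jk xk] := Hx r j r0.
have := Hr _ xk => h1.
have ik : (i <= T k)%N by rewrite -(subnKC jk); apply: leq_trans (Tm _ _).
have h2 := Hu k i ik.
have := far j (k - j)%N i iT; rewrite subnKC // => h3.
have ek : eps k <= eps j.
  rewrite -(subnKC jk); elim: (k - j)%N => [|l IH]; first by rewrite addn0.
  by rewrite addnS; have := epsS (j + l)%N; have := eps_gt0 (j + l).+1; lra.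
have h4 := dist_triangle dmet (iter i f (u k)) (iter i f x) (W j s i).
have h5 := dist_triangle dmet (W k s i) (iter i f (u k)) (W j s i).
have h6 := eps_gt0 k.
by move: h5; rewrite (dist_sym dmet (W k s i)); lra.
Qed.

(** * The scrambled Cantor set *)

Lemma codes_infinitely_often : exists C : nat -> seq (seq bool),
  forall c j0, exists2 j, (j0 <= j)%N & C j = c.
Proof.
exists (fun j => if (unpickle j : option (seq (seq bool) * nat)) is Some (c, _)
  then c else [::]) => c j0.
have [k le] : exists k : nat, (j0 <= pickle (c, k))%N.
  by apply: (@injective_unbounded (fun k => pickle (c, k))) => i j /(pcan_inj pickleK)[].
by exists (pickle (c, k)); rewrite // pickleK.
Qed.

(** It suffices that the prefix of [s] is listed: the common symbol is then an index below [size C],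
    so [s'] matches the same entry. *)
Lemma symbol_inj (C : seq (seq bool)) (B : nat) (s s' : nat -> bool) :
  (forall l, l \in C -> size l = B) -> mkseq s B \in C ->
  symbol C s = symbol C s' -> mkseq s B = mkseq s' B.
Proof.
move=> CB sC E.
have hs : has (fun l => l == mkseq s (size l)) C.
  by apply/hasP; exists (mkseq s B) => //; rewrite size_mkseq.
have hs' : has (fun l => l == mkseq s' (size l)) C.
  by rewrite has_find -[find _ _]/(symbol C s') -E -has_find.
have := nth_find [::] hs; have := nth_find [::] hs'.
rewrite -[find _ _]/(symbol C s') -E -[find _ _]/(symbol C s).
rewrite (CB (nth [::] C (symbol C s))) ?mem_nth ?/(symbol C s) -?has_find //.
by move=> /eqP -> /eqP ->.
Qed.

Lemma scrambled_cantor : 40 * e0 < d (lc (a k0)) (lc (b k0)) ->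
  exists (S : set X) (delta : nat -> R),
    [/\ mycielski d S, forall n, 0 < delta n &
        forall n, dist_scrambled_set d f n (delta n) S].
Proof.
move=> sep_ab; have [C HC] := codes_infinitely_often.
have [T [W [tau [HW WW Wfin Htau phase]]]] := stages C.
have leT j : (T j <= T j.+1)%N.
  have [_ h1 h2] := Htau j; apply: leq_trans h1 (leq_trans _ h2).
  exact: leq_addr.
have [g Hg] := limit_points HW WW leT.
have Hphase j s i : (i <= phase_length (C j) j (tau j))%N ->
    d (iter (tau j + i) f (g s)) (W j.+1 s (tau j + i)%N) < 6 * eps j.+1.
  move=> le; apply: Hg; have [_ _ h] := Htau j; apply: leq_trans h.
  by rewrite leq_add2l.
have near j s s' i : symbol (C j) s = symbol (C j) s' ->
    (i <= phase_length (C j) j (tau j))%N ->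
    d (iter (tau j + i) f (g s)) (iter (tau j + i) f (g s')) < 12 * eps j.+1.
  move=> E le; have := Hphase j s i le; have := Hphase j s' i le.
  have [/(_ s s' i E le) <- _] := phase j.
  set w := W _ _ _; have := dist_triangle dmet w (iter (tau j + i) f (g s)) (iter (tau j + i) f (g s')).
  by rewrite (dist_sym dmet w); lra.
(* Each orbit is within 4 e0 + 6 e0 of its pattern, and the patterns are more than 40 e0 apart at a
   suitable time. *)
have far j s s' i : symbol (C j) s <> symbol (C j) s' -> (i <= j.+1 * tau j)%N ->
    exists2 t, (t <= (size (C j)).+2 * K0)%N &
      20 * e0 < d (iter (tau j + i + t) f (g s)) (iter (tau j + i + t) f (g s')).
  move=> /eqP ne le.
  have [t [tle pb pa]] := pattern_sep i (symbol_lt (C j) s) (symbol_lt (C j) s') ne.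
  exists t => //.
  have it : (i + t <= phase_length (C j) j (tau j))%N by rewrite leq_add.
  have [_ hp] := phase j.
  have := hp s _ it; have := hp s' _ it; rewrite pa pb.
  have := Hphase j s _ it; have := Hphase j s' _ it.
  rewrite addnA; set w := W _ s _; set w' := W _ s' _.
  set x := iter _ _ (g s); set x' := iter _ _ (g s'); have := eps_le_e0 j.+1.
  have := dist_triangle dmet w (lc (b k0)) (lc (a k0)).
  have := dist_triangle dmet x w (lc (a k0)).
  have := dist_triangle dmet x' x (lc (a k0)).
  have := dist_triangle dmet w' x' (lc (a k0)).
  move: sep_ab; rewrite (dist_sym dmet (lc (a k0)) (lc (b k0))).
  by rewrite (dist_sym dmet (lc (b k0)) w) (dist_sym dmet w x); lra.
(* Two points this close stay within [20 * e0] during the whole waiting time for a list of [n]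
   prefixes, which contradicts [far]. *)
have /choice[delta Hdelta] : forall n, exists r, 0 < r /\ forall t x y,
    (t <= n.+2 * K0)%N -> d x y <= r -> d (iter t f x) (iter t f y) < 20 * e0.
  move=> n; have e200 : 0 < 20 * e0 by rewrite mulr_gt0.
  have [r r0 Hr] := compact_unif_continuous_iter dmet dcpt fcont (n.+2 * K0) e200.
  exists (r / 2); split=> [|t x y tn xy]; first by lra.
  by apply: Hr => //; lra.
(* When the list is the single prefix of [s] of length [N], any other prefix gets another symbol,
   and [far] separates the orbits before a time fixed by [s] and [N]. *)
have ginv s N : exists2 r, 0 < r & forall s',
    d (g s) (g s') < r -> forall i, (i < N)%N -> s i = s' i.
  have [j _ Cj] := HC [:: mkseq s N] 0%N.
  have e200 : 0 < 20 * e0 by rewrite mulr_gt0.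
  have [r r0 Hr] := compact_unif_continuous_iter dmet dcpt fcont
    (tau j + 0 + (size (C j)).+2 * K0) e200.
  exists r => // s' ss' i iN; apply: contrapT => ne.
  have [||t tle] := @far j s s' 0%N => //.
    rewrite Cj => /(@symbol_inj _ N) E; apply: ne.
    have /(congr1 (fun l => nth true l i)) : mkseq s N = mkseq s' N.
      by apply: E; rewrite ?mem_head // => l; rewrite inE => /eqP ->; rewrite size_mkseq.
    by rewrite !nth_mkseq.
  apply/negP; rewrite -leNgt ltW // Hr //.
  by rewrite leq_add2l.
have ginj : injective g.
  move=> s s' E; apply/funext => i; have [r r0] := ginv s i.+1.
  by apply=> //; rewrite E dist_refl.
exists (range g), delta; split=> [|n|n x xinj xS].
- exists (fun=> range g); split; last first.
    by apply/seteqP; split => [y gy|y [_ _ //]]; exists 0%N.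
  move=> _; exists g; split=> // s r r0.
  have r12 : 0 < r / 12 by lra.
  (* Agreement on [B] coordinates gives the same word at stage [J], whose first point is within r/2
     of both images. *)
  have [J HJ] := eps_small r12; have [B HB] := Wfin J.
  exists B => s' ss'; have := Hg J s 0%N (leq0n _); have := Hg J s' 0%N (leq0n _).
  rewrite -(HB _ _ ss') /=; have := HJ J (leqnn _).
  set w := W _ _ _; have := dist_triangle dmet w (g s) (g s').
  by rewrite (dist_sym dmet w); lra.
- by have [] := Hdelta n.
- have /choice[s Hs] : forall i, exists s, g s = x i.
    by move=> i; have [s _ E] := xS i; exists s.
  split=> [r r0|].
    apply: upper_density_one_of_blocks => j0.
    have r12 : 0 < r / 12 by lra.
    have [J HJ] := eps_small r12.
    (* With the empty list all points share one symbol and stay close during the phase. *)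
    have [j jge Cj] := HC [::] (maxn j0 J).
    have [tau0 _ _] := Htau j.
    exists j, (tau j); split => //; first by apply: leq_trans jge; rewrite leq_maxl.
    move=> i ile i1 i2 _; rewrite -!Hs.
    have le : (J <= j.+1)%N by rewrite leqW // (leq_trans _ jge) // leq_maxr.
    apply: lt_trans (near j _ _ _ _ _) _; rewrite ?Cj //.
      by rewrite /phase_length (leq_trans (ltnW ile)) // leq_addr.
    by have := HJ _ le; lra.
  (* A prefix length at which the [n] points are all distinguished; listing these prefixes gives
     them distinct symbols. *)
  have [B HB] : exists B, forall (ii : 'I_n * 'I_n) B', (B <= B')%N ->
      ii.1 <> ii.2 -> mkseq (s ii.1) B' <> mkseq (s ii.2) B'.
    apply: forall_fin_max => -[i1 i2] /=.
    have [->|ne] := eqVneq i1 i2; first by exists 0%N.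
    have [k sk] : exists k, s i1 k <> s i2 k.
      apply/existsNP => E; move/eqP: ne; apply; apply: xinj.
      by rewrite -!Hs; congr (g _); apply/funext.
    exists k.+1 => B' kB' _ /(congr1 (fun l => nth true l k)).
    by rewrite !nth_mkseq.
  pose c := [seq mkseq (s i) B | i <- enum 'I_n].
  apply: upper_density_one_of_blocks => j0.
  have [j jge Cj] := HC c j0; have [tau0 _ _] := Htau j.
  exists j, (tau j); split => // i ile i1 i2 i12; rewrite -!Hs ltNge.
  apply/negP => close.
  have [||t tle] := @far j (s i1) (s i2) i; last 1 first.
  + apply/negP; rewrite -leNgt ltW // addnC 2!(iterD t).
    apply: (Hdelta n).2 => //.
    by move: tle; rewrite Cj size_map size_enum_ord.
  + rewrite Cj => /(@symbol_inj _ B) E.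
    apply: (HB (i1, i2) B (leqnn _)) => /=.
      by move=> E'; move: i12; rewrite E' ltnn.
    apply: E; last by apply: map_f; rewrite mem_enum.
    by move=> l /mapP[i' _ ->]; rewrite size_mkseq.
  + exact: ltnW.
Qed.

End Stages.

Theorem theorem1p2 (R : realType) (X : Type) (d : X -> X -> R) (f : X -> X) :
  is_metric d -> mcompact d -> mcontinuous d f -> shadowing d f ->
  dim_zero d -> (0 < htop d f)%E ->
  exists (S : set X) (delta : nat -> R),
    [/\ mycielski d S,
        (forall n, (2 <= n)%N -> 0 < delta n) &
        (forall n, (2 <= n)%N -> dist_scrambled_set d f n (delta n) S)].
Proof.
move=> dmet dcpt fcont shad [X0 _] hpos.
have [es es0 Hes] := entropy_level dmet dcpt fcont X0 hpos.
(* The separation [es] is fixed before any tolerance, so [e0], and then [delta0] by shadowing, may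
   be chosen in terms of it. *)
pose e0 := es / 40; have e00 : 0 < e0 by rewrite /e0; lra.
have [delta0 delta00 Hd] := shad e0 e00.
have [L [v [a [b [k [LD E [a0 aK wa] [b0 bK wb] [kK ab]]]]]]] := Hes _ delta00.
have [|| S [delta [HS Hdelta Hsc]]] := scrambled_cantor dmet dcpt fcont E kK a0 aK wa b0 bK wb shad e00.
- by rewrite /shadows LD.
- by rewrite /e0; lra.
- by exists S, delta.
Qed.
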